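(* Let $K=\bigcup_{\ell=1}^L[a_\ell,b_\ell]$ with $-1=a_1<b_1<a_2<b_2<\cdots<a_L<b_L=1$, let $w$ be a positive continuous function on $K$, and let $N$ be a nonnegative integer. Let $\mathcal{U}_N^K$ be a minimizer of $\|P/w\|_{L_1(K)}$ over all monic real polynomials $P$ of degree $N$ and, for an integer $d\ge N$, let $\mathcal{V}_{N,d}^K$ be a minimizer of $|||P|||_d$ over all monic real polynomials $P$ of degree $N$. Then, for any $d\ge N$, $$|||\mathcal{V}_{N,d}^K|||_d\le\left\|\mathcal{U}_N^K/w\right\|_{L_1(K)}\le\left\|\mathcal{V}_{N,d}^K/w\right\|_{L_1(K)},$$ hence the weighted $L_1$-norm of $\mathcal{U}_N^K$ on $K$ is approximated with relative error $$\delta_{N,d}^K:=1-\frac{|||\mathcal{V}_{N,d}^K|||_d}{\|\mathcal{V}_{N,d}^K/w\|_{L_1(K)}}\ge0,$$ i.e. $(1-\delta_{N,d}^K)\,\|\mathcal{V}_{N,d}^K/w\|_{L_1(K)}\le\|\mathcal{U}_N^K/w\|_{L_1(K)}\le\|\mathcal{V}_{N,d}^K/w\|_{L_1(K)}$.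
   Context: Polynomials $P$ of degree at most $N$ are written $P=\sum_{n=0}^Np_nT_n$ with $\mathbf{p}=(p_0,\dots,p_N)\in\mathbb{R}^{N+1}$, where $T_n(\cos\theta)=\cos(n\theta)$; $U_n$ is the Chebyshev polynomial of the second kind, $U_n(\cos\theta)=\sin((n+1)\theta)/\sin\theta$. The weighted $L_1$-norm is $\|P/w\|_{L_1(K)}=\sum_{\ell=1}^L\int_{a_\ell}^{b_\ell}\frac{|P(t)|}{w(t)}\,dt$. For $x\in[-1,1]$, $P_\ell(x)=P\left(\frac{(b_\ell-a_\ell)x+a_\ell+b_\ell}{2}\right)$ and $w_\ell(x)=w\left(\frac{(b_\ell-a_\ell)x+a_\ell+b_\ell}{2}\right)$. The matrix $\mathbf{W}^\ell\in\mathbb{R}^{(N+1)\times(N+1)}$ represents the linear map sending the Chebyshev coefficients $\mathbf{p}$ of $P$ to the coefficients of $P_\ell$ in the second-kind basis, i.e. $P_\ell=\sum_{n=0}^N(\mathbf{W}^\ell\mathbf{p})_nU_n$. The matrix $\mathbf{J}^{\ell,d}\in\mathbb{R}^{(d+1)\times(N+1)}$ has entries $J^{\ell,d}_{k,n}=\int_0^\pi\frac{\cos(k\theta)\sin((n+1)\theta)}{w_\ell(\cos\theta)}\,d\theta$, $0\le k\le d$, $0\le n\le N$. For $\mathbf{y}=(y_0,\dots,y_d)\in\mathbb{R}^{d+1}$, $\mathbf{Toep}_d(\mathbf{y})\in\mathbb{R}^{(d+1)\times(d+1)}$ is the symmetric Toeplitz matrix with $(i,j)$ entry $y_{|i-j|}$,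 and $\succeq0$ means positive semidefinite. For $d\ge N$ and a real polynomial $P$ of degree at most $N$ with Chebyshev coefficient vector $\mathbf{p}$, the ersatz norm $|||P|||_d$ is the minimum of $\sum_{\ell=1}^L\frac{b_\ell-a_\ell}{2}(y_0^{\ell,+}+y_0^{\ell,-})$ over all $\mathbf{y}^{1,\pm},\dots,\mathbf{y}^{L,\pm}\in\mathbb{R}^{d+1}$ subject to $\mathbf{y}^{\ell,+}-\mathbf{y}^{\ell,-}=\mathbf{J}^{\ell,d}\mathbf{W}^\ell\mathbf{p}$, $\mathbf{Toep}_d(\mathbf{y}^{\ell,+})\succeq0$ and $\mathbf{Toep}_d(\mathbf{y}^{\ell,-})\succeq0$ for all $\ell=1,\dots,L$. *)

(* Defs.v *)
From HB Require Import structures.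
From mathcomp Require Import all_boot all_order all_algebra.
From mathcomp Require Import all_classical all_reals all_analysis.
From mathcomp Require Import ring lra.

Set Implicit Arguments.
Unset Strict Implicit.
Unset Printing Implicit Defensive.

Import Order.TTheory GRing.Theory Num.Theory.
Import numFieldNormedType.Exports.

Local Open Scope classical_set_scope.
Local Open Scope ring_scope.

Section Chebyshev.
Variable R : realType.

Fixpoint chebT (n : nat) : {poly R} :=
  match n with
  | 0 => 1
  | 1 => 'X
  | (m.+1 as k).+1 => 2 *: ('X * chebT k) - chebT m
  end.

Fixpoint chebU (n : nat) : {poly R} :=
  match n with
  | 0 => 1
  | 1 => 2 *: 'X
  | (m.+1 as k).+1 => 2 *: ('X * chebU k) - chebU m
  end.

Lemma chebTSS n : chebT n.+2 = 2 *: ('X * chebT n.+1) - chebT n.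
Proof. by []. Qed.

Lemma chebUSS n : chebU n.+2 = 2 *: ('X * chebU n.+1) - chebU n.
Proof. by []. Qed.

Lemma chebT_cos n (theta : R) : (chebT n).[cos theta] = cos (n%:R * theta).
Proof.
elim/ltn_ind: n => -[|[|n]] IH.
- by rewrite /= mul0r cos0 hornerE.
- by rewrite /= mul1r hornerX.
rewrite chebTSS hornerD hornerN hornerZ hornerM hornerX !IH //.
have -> : n.+2%:R * theta = n.+1%:R * theta + theta.
  by rewrite -(natr1 n.+1) mulrDl mul1r.
have -> : n%:R * theta = n.+1%:R * theta - theta.
  by rewrite -(natr1 n) mulrDl mul1r addrK.
rewrite cosB cosD; ring.
Qed.

Lemma chebU_cos n (theta : R) :
  (chebU n).[cos theta] * sin theta = sin (n.+1%:R * theta).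
Proof.
elim/ltn_ind: n => -[|[|n]] IH.
- by rewrite /= !hornerE.
- have -> : 2%:R * theta = theta + theta by ring.
  by rewrite /= !hornerE sinD; ring.
rewrite chebUSS hornerD hornerN hornerZ hornerM hornerX mulrBl -!mulrA !IH //.
have -> : n.+3%:R * theta = n.+2%:R * theta + theta.
  by rewrite -(natr1 n.+2) mulrDl mul1r.
have -> : n.+1%:R * theta = n.+2%:R * theta - theta.
  by rewrite -(natr1 n.+1) mulrDl mul1r addrK.
rewrite sinB sinD; ring.
Qed.

Lemma size_cheb_rec (p q : {poly R}) n :
  size p = n.+1 -> (size q <= n.+1)%N -> size (2 *: ('X * p) - q) = n.+2.
Proof.
move=> sp sq; have p0 : p != 0 by rewrite -size_poly_eq0 sp.
have s1 : size (2 *: ('X * p)) = n.+2.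
  by rewrite size_scale ?pnatr_eq0 // mulrC size_mulX // sp.
by rewrite size_polyDl ?s1 // size_polyN.
Qed.

Lemma size_chebT n : size (chebT n) = n.+1.
Proof.
elim/ltn_ind: n => -[|[|n]] IH; rewrite ?size_poly1 ?size_polyX //.
by rewrite chebTSS (@size_cheb_rec _ _ n.+1) ?IH // ltnW.
Qed.

Lemma size_chebU n : size (chebU n) = n.+1.
Proof.
elim/ltn_ind: n => -[|[|n]] IH; rewrite ?size_poly1 //.
  by rewrite [chebU _]/= size_scale ?pnatr_eq0 // size_polyX.
by rewrite chebUSS (@size_cheb_rec _ _ n.+1) ?IH // ltnW.
Qed.

(* Column n holds the monomial coefficients of B n. *)
Definition basis_mx (B : nat -> {poly R}) (N : nat) : 'M[R]_N.+1 :=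
  \matrix_(j < N.+1, n < N.+1) (B n)`_j.

(* Coordinates of P in the basis B 0, ..., B N of the polynomials of degree at
   most N, when each B n has degree n. *)
Definition coords (B : nat -> {poly R}) (N : nat) (P : {poly R}) :
    'cV[R]_N.+1 :=
  invmx (basis_mx B N) *m \col_(j < N.+1) P`_j.

Lemma basis_mx_unit (B : nat -> {poly R}) N :
  (forall n, size (B n) = n.+1) -> basis_mx B N \in unitmx.
Proof.
move=> sB; rewrite -unitmx_tr unitmxE det_trig.
  rewrite unitfE; apply/prodf_neq0 => i _; rewrite !mxE.
  have : lead_coef (B i) != 0 by rewrite lead_coef_eq0 -size_poly_eq0 sB.
  by rewrite lead_coefE sB.
apply/is_trig_mxP => i j ij; rewrite !mxE nth_default // sB //.
Qed.

Lemma coordsE (B : nat -> {poly R}) N (P : {poly R}) :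
  (forall n, size (B n) = n.+1) -> (size P <= N.+1)%N ->
  P = \sum_(n < N.+1) coords B N P n ord0 *: B n.
Proof.
move=> sB sP; apply/polyP => j; rewrite coef_sum.
have [jN|Nj] := ltnP j N.+1; last first.
  rewrite nth_default ?(leq_trans sP) // big1 // => n _.
  by rewrite coefZ nth_default ?mulr0 // sB (leq_trans _ Nj).
have := congr1 (fun v : 'cV[R]_N.+1 => v (Ordinal jN) ord0)
  (mulKVmx (basis_mx_unit N sB) (\col_(j < N.+1) P`_j : 'cV[R]_N.+1)).
rewrite -/(coords B N P) !mxE /= => <-.
by apply: eq_bigr => n _; rewrite coefZ mxE mulrC.
Qed.

Definition affine (alpha beta x : R) : R :=
  ((beta - alpha) * x + alpha + beta) / 2.

Definition affine_poly (alpha beta : R) : {poly R} :=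
  ((beta - alpha) / 2) *: 'X + ((alpha + beta) / 2)%:P.

Lemma affine_polyE alpha beta x :
  (affine_poly alpha beta).[x] = affine alpha beta x.
Proof. by rewrite /affine_poly /affine !hornerE; field. Qed.

(* The following matrices are indexed by the end points of an interval
   [alpha, beta] rather than by the number of that interval. *)
Definition Wmx (N : nat) (alpha beta : R) : 'M[R]_N.+1 :=
  \matrix_(m < N.+1, n < N.+1)
    coords chebU N (chebT n \Po affine_poly alpha beta) m ord0.

Lemma WmxE N alpha beta (p : 'cV[R]_N.+1) :
  (\sum_(n < N.+1) p n ord0 *: chebT n) \Po affine_poly alpha beta =
  \sum_(m < N.+1) (Wmx N alpha beta *m p) m ord0 *: chebU m.
Proof.
have sA : (size (affine_poly alpha beta) <= 2)%N.
  rewrite (leq_trans (size_polyD _ _)) // geq_max size_polyC.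
  rewrite (leq_trans (size_scale_leq _ _)) ?size_polyX //.
  by case: (_ == 0).
rewrite raddf_sum /=.
transitivity (\sum_(n < N.+1) \sum_(m < N.+1)
    (Wmx N alpha beta m n * p n ord0) *: chebU m).
  apply: eq_bigr => n _; rewrite comp_polyZ.
  have sT : (size (chebT n \Po affine_poly alpha beta) <= N.+1)%N.
    apply: leq_trans (size_comp_poly_leq _ _) _; rewrite size_chebT /=.
    rewrite ltnS (leq_trans _ (leq_ord n)) // -[leqRHS]muln1 leq_mul2l.
    by apply/orP; right; move: sA; case: (size _) => // -[|[]].
  rewrite [X in _ *: X](coordsE size_chebU sT) scaler_sumr.
  by apply: eq_bigr => m _; rewrite scalerA mulrC [Wmx _ _ _ _ _]mxE.
rewrite exchange_big /=; apply: eq_bigr => m _.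
by rewrite !mxE scaler_suml.
Qed.

Definition Jmx (d N : nat) (w : R -> R) (alpha beta : R) :
    'M[R]_(d.+1, N.+1) :=
  \matrix_(k < d.+1, n < N.+1)
    \int[lebesgue_measure]_(theta in `[0, pi])
      (cos (k%:R * theta) * sin (n.+1%:R * theta)
       / w (affine alpha beta (cos theta))).

End Chebyshev.

Section ErsatzNorm.
Variable R : realType.

Definition psd (n : nat) (A : 'M[R]_n) : Prop :=
  A^T = A /\ forall x : 'cV[R]_n, 0 <= (x^T *m A *m x) ord0 ord0.

(* inord is harmless: |i - j| <= d. *)
Definition Toep (d : nat) (y : 'cV[R]_d.+1) : 'M[R]_d.+1 :=
  \matrix_(i < d.+1, j < d.+1) y (inord `|i - j|%N) ord0.

(* There are L.+1 intervals [a l, b l], so that there is at least one. *)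
Definition Kset (L : nat) (a b : 'I_L.+1 -> R) : set R :=
  [set t | exists l, t \in `[a l, b l]].

Definition wL1norm (L : nat) (a b : 'I_L.+1 -> R) (w : R -> R)
    (P : {poly R}) : R :=
  \sum_(l < L.+1) \int[lebesgue_measure]_(t in `[a l, b l]) (`|P.[t]| / w t).

Definition ersatz_feasible (L : nat) (a b : 'I_L.+1 -> R) (w : R -> R)
    (N d : nat) (P : {poly R}) (yp ym : 'I_L.+1 -> 'cV[R]_d.+1) : Prop :=
  forall l, [/\ yp l - ym l =
                  Jmx d N w (a l) (b l) *m
                    (Wmx N (a l) (b l) *m coords (@chebT R) N P),
                psd (Toep (yp l)) & psd (Toep (ym l))].

Definition ersatz_objective (L : nat) (a b : 'I_L.+1 -> R) (d : nat)
    (yp ym : 'I_L.+1 -> 'cV[R]_d.+1) : R :=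
  \sum_(l < L.+1) (b l - a l) / 2 * (yp l ord0 ord0 + ym l ord0 ord0).

(* This infimum is a minimum, see [ersatz_norm_min]. It is meaningful for P of
   degree at most N. *)
Definition ersatz_norm (L : nat) (a b : 'I_L.+1 -> R) (w : R -> R)
    (N d : nat) (P : {poly R}) : R :=
  inf [set v | exists yp ym, ersatz_feasible a b w N P yp ym /\
                             v = ersatz_objective (d := d) a b yp ym].

Definition is_minimizer (T : Type) (A : set T) (f : T -> R) (x : T) : Prop :=
  A x /\ forall y, A y -> f x <= f y.

Definition monic_deg (N : nat) : set {poly R} :=
  [set P | P \is monic /\ size P = N.+1].

Lemma Toep_quad d (y x : 'cV[R]_d.+1) :
  (x^T *m Toep y *m x) ord0 ord0 =
  \sum_j \sum_i x i ord0 * x j ord0 * y (inord `|i - j|%N) ord0.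
Proof.
rewrite mxE; apply: eq_bigr => j _; rewrite mxE mulr_suml.
by apply: eq_bigr => i _; rewrite !mxE; ring.
Qed.

Lemma Toep_sym d (y : 'cV[R]_d.+1) : (Toep y)^T = Toep y.
Proof. by apply/matrixP => i j; rewrite !mxE distnC. Qed.

Lemma psd_Toep d (y : 'cV[R]_d.+1) : psd (Toep y) <->
  forall x : 'cV[R]_d.+1,
    0 <= \sum_j \sum_i x i ord0 * x j ord0 * y (inord `|i - j|%N) ord0.
Proof.
split=> [[_ h] x|h]; first by rewrite -Toep_quad.
by split; [exact: Toep_sym|move=> x; rewrite Toep_quad].
Qed.

Lemma psd_Toep_bound d (y : 'cV[R]_d.+1) k :
  psd (Toep y) -> `|y k ord0| <= y ord0 ord0.
Proof.
move=> [_ h].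
have T00 i : Toep y i i = y ord0 ord0.
  by rewrite mxE distnn; congr (y _ _); apply/val_inj; rewrite /= inordK.
have T0k : Toep y ord0 k = y k ord0.
  by rewrite mxE dist0n inord_val.
have Tk0 : Toep y k ord0 = y k ord0.
  by rewrite mxE distn0 inord_val.
have q (s : R) :
    0 <= y ord0 ord0 + s * y k ord0 + s * y k ord0 + s * s * y ord0 ord0.
  have := h (delta_mx ord0 ord0 + s *: delta_mx k ord0).
  move: (Toep y) T00 T0k Tk0 => A T00 T0k Tk0.
  rewrite [(_ + _)^T]linearD /= [(_ *: _)^T]linearZ /= !trmx_delta.
  rewrite mulmxDl -scalemxAl -!rowE mulmxDr !mulmxDl.
  rewrite -!scalemxAr -!scalemxAl -!colE !mxE !T00 T0k Tk0.
  move=> /le_trans; apply; rewrite le_eqVlt; apply/orP; left.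
  by apply/eqP; ring.
have := q 1; have := q (-1); rewrite ler_norml => h1 h2.
by apply/andP; split; lra.
Qed.

Lemma sum_continuous (T : topologicalType) (I : Type) (r : seq I)
    (F : I -> T -> R) :
  (forall i, continuous (F i)) -> continuous (fun v => \sum_(i <- r) F i v).
Proof.
move=> cF; elim: r => [|i r IH] v.
  by under eq_fun do rewrite big_nil; exact: cvg_cst.
under eq_fun do rewrite big_cons.
by apply: cvgD; [exact: cF|exact: IH].
Qed.

Lemma closed_psd_Toep d (z : 'cV[R]_d.+1) :
  closed [set v : 'rV[R]_d.+1 | psd (Toep (v^T + z))].
Proof.
have zc k : continuous (fun v : 'rV[R]_d.+1 => (v^T + z) k ord0).
  rewrite (_ : (fun v => _) = fun v : 'rV[R]_d.+1 => v ord0 k + z k ord0).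
    move=> v; have cv := @coord_continuous R 1 d.+1 ord0 k v.
    apply: (@continuousD R R _ (fun v : 'rV[R]_d.+1 => v ord0 k)
      (fun=> z k ord0) v cv).
    exact: cst_continuous.
  by apply/funext => v; rewrite !mxE.
rewrite (_ : mkset _ = \bigcap_(x in [set: 'cV[R]_d.+1])
   ((fun v : 'rV[R]_d.+1 => \sum_j \sum_i x i ord0 * x j ord0 *
     (v^T + z) (inord `|i - j|%N) ord0) @^-1` [set t | 0 <= t])); last first.
  by apply/seteqP; split => v /=;
    [move=> /psd_Toep h x _ /=|move=> h; apply/psd_Toep => x; apply: h].
apply: closed_bigI => x _; apply: preimage_closed; last exact: closed_ge.
move=> v _; apply: sum_continuous => j; apply: sum_continuous => i {}v.
apply: (@continuousM R _ (fun=> _) (fun v : 'rV[R]_d.+1 => (v^T + z) _ ord0)).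
  exact: cst_continuous.
exact: zc.
Qed.

Lemma psd_Toep_shift d (z : 'cV[R]_d.+1) (c : R) :
  \sum_k `|z k ord0| * d.+1%:R <= c ->
  psd (Toep (c *: delta_mx ord0 ord0 + z)).
Proof.
set M := \sum_k `|z k ord0|; rewrite -mulr_suml -/M => Mc.
apply/psd_Toep => x; set S := \sum_i x i ord0 ^+ 2.
have zM k : `|z k ord0| <= M.
  by rewrite /M (bigD1 k) //= lerDl sumr_ge0.
have S0 : 0 <= S by apply: sumr_ge0 => i _; exact: sqr_ge0.
under eq_bigr do (under eq_bigr do rewrite mxE mulrDr; rewrite big_split /=).
rewrite big_split /=.
have -> : \sum_(j < d.+1) \sum_(i < d.+1) x i ord0 * x j ord0 *
    (c *: delta_mx ord0 ord0 : 'cV[R]_d.+1) (inord `|i - j|%N) ord0 = c * S.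
  rewrite mulr_sumr; apply: eq_bigr => j _.
  rewrite (bigD1 j) //= big1 => [|i ij].
    rewrite !mxE distnn (_ : inord 0 = ord0) ?eqxx /=.
      by rewrite addr0; ring.
    by apply/val_inj; rewrite /= inordK.
  rewrite !mxE (_ : (inord _ == ord0) = false) ?andFb ?mulr0 //.
  apply/negbTE; apply: contra ij => /eqP/(congr1 val) /=.
  rewrite inordK => [/eqP|]; first by rewrite distn_eq0 => /eqP/ord_inj ->.
  rewrite ltnS; case: (leqP i j) => h.
    by rewrite distnEr // (leq_trans (leq_subr _ _)) // leq_ord.
  by rewrite distnEl ?(ltnW h) // (leq_trans (leq_subr _ _)) // leq_ord.
apply: (@le_trans _ _ (c * S - \sum_(j < d.+1) \sum_(i < d.+1)
    (M / 2) * (x i ord0 ^+ 2 + x j ord0 ^+ 2))).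
  have -> : \sum_(j < d.+1) \sum_(i < d.+1)
      (M / 2) * (x i ord0 ^+ 2 + x j ord0 ^+ 2) = M * d.+1%:R * S.
    under eq_bigr do rewrite -mulr_sumr big_split /= sumr_const card_ord -/S.
    rewrite -mulr_sumr big_split /= sumr_const card_ord sumrMnl -/S.
    by rewrite -mulr_natl; field.
  by rewrite -mulrBl mulr_ge0 // subr_ge0.
rewrite lerD2l -sumrN; apply: ler_sum => j _.
rewrite -sumrN; apply: ler_sum => i _.
set t := z _ _; have tM : `|t| <= M by exact: zM.
have : `|x i ord0 * x j ord0 * t| <=
    (x i ord0 ^+ 2 + x j ord0 ^+ 2) / 2 * M.
  rewrite normrM ler_pM //.
  rewrite ler_norml; apply/andP; split.
    by have := sqr_ge0 (x i ord0 + x j ord0); nra.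
  by have := sqr_ge0 (x i ord0 - x j ord0); nra.
by rewrite ler_norml => /andP[h _]; lra.
Qed.

Lemma ersatz_single d (z : 'cV[R]_d.+1) : exists y : 'cV[R]_d.+1,
  [/\ psd (Toep (y + z)), psd (Toep y) &
      forall y', psd (Toep (y' + z)) -> psd (Toep y') ->
        y ord0 ord0 <= y' ord0 ord0].
Proof.
set c : R := \sum_k `|z k ord0| * d.+1%:R.
pose y0 : 'cV[R]_d.+1 := c *: delta_mx ord0 ord0.
have py0z : psd (Toep (y0 + z)) by exact: psd_Toep_shift.
have py0 : psd (Toep y0).
  rewrite -[y0]addr0; apply: psd_Toep_shift; rewrite big1 => [|k _].
    by apply: sumr_ge0 => k _; rewrite mulr_ge0.
  by rewrite mxE normr0 mul0r.
pose A : set 'rV[R]_d.+1 := [set v | psd (Toep (v^T + z))] `&`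
  ([set v | psd (Toep (v^T + 0))] `&`
   (fun v : 'rV[R]_d.+1 => v ord0 ord0) @^-1` [set t | t <= c]).
have cA : closed A.
  apply: closedI; first exact: closed_psd_Toep.
  apply: closedI; first exact: closed_psd_Toep.
  apply: preimage_closed; last exact: closed_le.
  by move=> v _; exact: coord_continuous.
have kA : compact A.
  apply: (subclosed_compact cA
    (@rV_compact R _ (fun=> `[- c, c]%classic) (fun=> @segment_compact _ _ _))).
  move=> v [_ [+ /= vc]] i; rewrite /= addr0 in_itv /= -ler_norml.
  by move=> /(psd_Toep_bound i); rewrite !mxE => /le_trans; apply.
have A0 : A y0^T.
  split; rewrite /= ?trmxK ?addr0 //; split=> //.
  by rewrite !mxE /= mulr1.
have [v] := @EVT_min_rV R _ (fun v : 'rV[R]_d.+1 => v ord0 ord0) A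
  (ex_intro _ _ A0) kA (continuous_subspaceT (@coord_continuous _ _ _ _ _)).
rewrite inE => -[/= vz [v0 vc]] vmin; exists v^T; split => //.
  by rewrite -[v^T]addr0.
move=> y' yz yy; rewrite mxE; have [yc|/ltW cy] := leP (y' ord0 ord0) c.
  have := vmin y'^T; rewrite mxE inE; apply.
  by split; rewrite /= ?trmxK ?addr0 // mxE.
exact: le_trans cy.
Qed.

Lemma ersatz_norm_min (L : nat) (a b : 'I_L.+1 -> R) (w : R -> R)
    (N d : nat) (P : {poly R}) :
  (forall l, a l <= b l) ->
  (exists yp ym, ersatz_feasible (d := d) a b w N P yp ym /\
     ersatz_objective a b yp ym = ersatz_norm a b w N d P) /\
  (forall yp ym, ersatz_feasible (d := d) a b w N P yp ym ->
     ersatz_norm a b w N d P <= ersatz_objective a b yp ym).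
Proof.
move=> ab; pose z l := Jmx d N w (a l) (b l) *m
  (Wmx N (a l) (b l) *m coords (@chebT R) N P).
have [y hy] := choice (fun l => ersatz_single (z l)).
have fy : ersatz_feasible a b w N P (fun l => y l + z l) y.
  by move=> l; have [? ? _] := hy l; split; rewrite // addrAC subrr add0r.
have miny (yp ym : 'I_L.+1 -> 'cV[R]_d.+1) : ersatz_feasible a b w N P yp ym ->
    ersatz_objective a b (fun l => y l + z l) y <= ersatz_objective a b yp ym.
  move=> h; apply: ler_sum => l _; have [e pp pm] := h l.
  have [_ _ m] := hy l; rewrite ler_wpM2l ?divr_ge0 ?subr_ge0 //.
  have ypE : yp l = ym l + z l by rewrite /z -e addrC subrK.
  have := m (ym l); rewrite -ypE => /(_ pp pm) {}m.
  by rewrite ypE !mxE; lra.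
set E := [set v | exists yp ym, ersatz_feasible a b w N P yp ym /\
                             v = ersatz_objective (d := d) a b yp ym].
have lbE : lbound E (ersatz_objective a b (fun l => y l + z l) y).
  by move=> _ [yp [ym [/miny ? ->]]].
have infE : ersatz_norm a b w N d P =
    ersatz_objective a b (fun l => y l + z l) y.
  apply/eqP; rewrite eq_le; apply/andP; split.
    by apply: ge_inf; [exists (ersatz_objective a b (fun l => y l + z l) y)
      |exists (fun l => y l + z l), y].
  by apply: lb_le_inf => //; eexists; exists (fun l => y l + z l), y.
split; first by exists (fun l => y l + z l), y.
by move=> yp ym /miny; rewrite infE.
Qed.

End ErsatzNorm.

(* Main.v *)
(* On one interval [u, v], substitute t = ((v - u) cos theta + u + v) / 2: this
   turns the measure P(t)/w(t) dt into (v - u)/2 g(theta) dtheta with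
   g(theta) = P_l(cos theta) sin(theta) / w_l(cos theta), and J W p lists the
   cosine moments of g because U_n(cos theta) sin(theta) = sin((n+1) theta).
   The moments of the positive and negative parts of g have psd Toeplitz
   matrices and differ by J W p, so they are feasible for the ersatz problem,
   with objective value the integral of |g|. Hence the ersatz norm never exceeds
   the weighted L1 norm, and the inequalities follow by minimality. *)

Require Import Defs.
From mathcomp Require Import all_boot all_order all_algebra.
From mathcomp Require Import all_classical all_reals all_analysis.
From mathcomp Require Import ring lra.

Import Order.TTheory GRing.Theory Num.Theory.
Import numFieldNormedType.Exports.

Local Open Scope classical_set_scope.
Local Open Scope ring_scope.

(** * Preliminaries on continuity, integrals and cosines *)

Lemma integrable_within (R : realType) (u v : R) (f : R -> R) :
  {within `[u, v], continuous f} ->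
  lebesgue_measure.-integrable `[u, v] (EFin \o f).
Proof.
move=> cf; apply: continuous_compact_integrable => //.
exact: segment_compact.
Qed.

Lemma within_continuousM (R : realType) (A : set R) (f g : R -> R) :
  {within A, continuous f} -> {within A, continuous g} ->
  {within A, continuous (fun x => f x * g x)}.
Proof. by move=> cf cg x; apply: cvgM; [exact: cf|exact: cg]. Qed.

Lemma Rintegral_sum d (T : measurableType d) (R : realType)
    (mu : {measure set T -> \bar R}) (D : set T) (I : Type) (r : seq I)
    (f : I -> T -> R) :
  measurable D -> (forall i, mu.-integrable D (EFin \o f i)) ->
  \int[mu]_(x in D) (\sum_(i <- r) f i x) =
  \sum_(i <- r) \int[mu]_(x in D) f i x.
Proof.
move=> mD intf; elim: r => [|i r IH].
  under eq_Rintegral do rewrite big_nil.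
  by rewrite Rintegral_cst // mul0r big_nil.
under eq_Rintegral do rewrite big_cons.
rewrite big_cons -IH RintegralD //.
rewrite (_ : _ \o _ = fun x => (\sum_(i <- r) (f i x)%:E)%E).
  exact: (integrable_sum mD r (fun i _ => intf i)).
by apply/funext => x /=; rewrite sumEFin.
Qed.

(** Evenness of cosine absorbs the absolute value. The right side separates [i] from [j], so
    Toeplitz forms become sums of squares. *)
Lemma cos_distn (R : realType) (i j : nat) (t : R) :
  cos (`|i - j|%N%:R * t) =
  cos (i%:R * t) * cos (j%:R * t) + sin (i%:R * t) * sin (j%:R * t).
Proof.
rewrite -cosB -mulrBl; case: (leqP j i) => h.
  by rewrite distnEl // natrB.
by rewrite distnEr ?(ltnW h) // natrB ?(ltnW h) // -[RHS]cosN -mulNr opprB.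
Qed.

(** * Cosine moments on $[0,\pi]$ and their Toeplitz matrices *)

Section TrigonometricMoments.
Context {R : realType}.
Implicit Types f g : R -> R.

Definition moments (d : nat) (f : R -> R) : 'cV[R]_d.+1 :=
  \col_k \int[lebesgue_measure]_(t in `[0, pi]) (cos (k%:R * t) * f t).

Lemma within_cosM (k : nat) (f : R -> R) :
  {within `[0, pi], continuous f} ->
  {within `[0, pi], continuous (fun t => cos (k%:R * t) * f t)}.
Proof.
apply: within_continuousM; apply: continuous_subspaceT => t.
apply: (@continuous_comp _ _ _ (fun t : R => k%:R * t) cos).
  exact: mulrl_continuous.
exact: continuous_cos.
Qed.

(** The quadratic form at [x] is the integral of $|\sum_k x_k e^{ikt}|^2 f(t)$, with the squared
    modulus split into its cosine and sine parts. *)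
Lemma psd_moments (d : nat) (f : R -> R) :
  {within `[0, pi], continuous f} -> (forall t, 0 <= t <= pi -> 0 <= f t) ->
  psd (Toep (moments d f)).
Proof.
move=> cf f0; apply/psd_Toep => x.
have intc k (c : R) : lebesgue_measure.-integrable `[0, pi]
    (EFin \o (fun t => c * (cos (k%:R * t) * f t))).
  apply: integrable_within; apply: within_continuousM; last exact: within_cosM.
  by move=> t; exact: cvg_cst.
rewrite (_ : \sum_j _ = \int[lebesgue_measure]_(t in `[0, pi])
    (((\sum_(i < d.+1) x i ord0 * cos (i%:R * t)) ^+ 2 +
      (\sum_(i < d.+1) x i ord0 * sin (i%:R * t)) ^+ 2) * f t)).
  apply: Rintegral_ge0 => t; rewrite /= in_itv /= => /f0 ft0.
  by rewrite mulr_ge0 // addr_ge0 ?sqr_ge0.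
(* Indexing by pairs lets a single exchange of sum and integral handle the double sum. *)
transitivity (\int[lebesgue_measure]_(t in `[0, pi])
    (\sum_(p <- index_enum ('I_d.+1 * 'I_d.+1)%type)
      x p.2 ord0 * x p.1 ord0 * (cos (`|p.2 - p.1|%N%:R * t) * f t))).
  rewrite Rintegral_sum // pair_big /=; apply: eq_bigr => -[j i] _ /=.
  rewrite mxE RintegralZl //; last first.
    by apply: integrable_within; exact: within_cosM.
  (* Since $|i-j|\le d$, [inord] does not fall back on its default value. *)
  rewrite inordK // ltnS; case: (leqP i j) => h.
    by rewrite distnEr // (leq_trans (leq_subr _ _)) // leq_ord.
  by rewrite distnEl ?(ltnW h) // (leq_trans (leq_subr _ _)) // leq_ord.
apply: eq_Rintegral => t _.
rewrite -(pair_big predT predT (fun j i : 'I_d.+1 =>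
  x i ord0 * x j ord0 * (cos (`|i - j|%N%:R * t) * f t))) /=.
rewrite !expr2 !big_distrlr /= -big_split /= mulr_suml exchange_big /=.
apply: eq_bigr => i _; rewrite -big_split mulr_suml /=.
by apply: eq_bigr => j _; rewrite cos_distn; ring.
Qed.

Lemma momentsB (d : nat) f g :
  {within `[0, pi], continuous f} -> {within `[0, pi], continuous g} ->
  moments d f - moments d g = moments d (fun t => f t - g t).
Proof.
move=> cf cg; apply/colP => k; rewrite !mxE.
rewrite -RintegralB //; try by apply: integrable_within; exact: within_cosM.
by apply: eq_Rintegral => t _; rewrite mulrBr.
Qed.

(** The zeroth moment is the total mass; this is what the ersatz objective reads off. *)
Lemma moments0D (d : nat) f g :
  {within `[0, pi], continuous f} -> {within `[0, pi], continuous g} ->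
  moments d f ord0 ord0 + moments d g ord0 ord0 =
  \int[lebesgue_measure]_(t in `[0, pi]) (f t + g t).
Proof.
move=> cf cg; rewrite !mxE.
rewrite -RintegralD //; try by apply: integrable_within; exact: within_cosM.
by apply: eq_Rintegral => t _; rewrite !mul0r cos0 !mul1r.
Qed.

End TrigonometricMoments.

(** * The change of variable from $[u,v]$ to $[0,\pi]$ *)

Section CosineSubstitution.
Context {R : realType} {u v : R}.

Lemma affine_cos_itv (t : R) : u <= v -> affine u v (cos t) \in `[u, v].
Proof.
move=> uv; have := cos_geN1 t; have := cos_le1 t.
by rewrite in_itv /= /affine => h1 h2; apply/andP; split; nra.
Qed.

Lemma is_derive_affine_cos (t : R) :
  is_derive t 1 (fun s => affine u v (cos s)) (- ((v - u) / 2 * sin t)).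
Proof.
rewrite (_ : (fun s => _) =
    (((v - u) / 2) \*: (@cos R) + cst ((u + v) / 2)) :> (R -> R)); last first.
  apply/funext => s; rewrite /affine !fctE /=.
  by rewrite /GRing.scale /=; field.
apply: is_derive_eq.
by rewrite addr0 /GRing.scale /= mulrN.
Qed.

Lemma continuous_affine_cos : continuous (fun t : R => affine u v (cos t)).
Proof.
move=> t; apply/differentiable_continuous/derivable1_diffP.
by have [] := is_derive_affine_cos t.
Qed.

(** The inner map sends the whole line into $[u,v]$, so continuity of [G] there suffices for any
    [D]. *)
Lemma within_affine_cos (D : set R) (G : R -> R) : u <= v ->
  {within `[u, v], continuous G} ->
  {within D, continuous (fun t => G (affine u v (cos t)))}.
Proof.
move=> uv /subspace_continuousP cG; apply/subspace_continuousP => t _.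
apply: (cvg_trans _ (cG _ (affine_cos_itv t uv))) => /= A.
rewrite /within /= nbhs_simpl => hA.
have hs := continuous_affine_cos t _ hA.
change (nbhs t (fun s : R => D s -> A (G (affine u v (cos s))))).
move: hs; rewrite nbhs_simpl /=; apply: filterS => s /= h _.
by apply: h; exact: affine_cos_itv.
Qed.

(** Substitution along a map that decreases from [v] at 0 to [u] at [pi]; its derivative supplies
    the factor [(v - u) / 2 * sin t]. *)
Lemma Rintegral_affine_cos (G : R -> R) : u < v ->
  {within `[u, v], continuous G} ->
  \int[lebesgue_measure]_(x in `[u, v]) G x =
  (v - u) / 2 * \int[lebesgue_measure]_(t in `[0, pi])
    (G (affine u v (cos t)) * sin t).
Proof.
move=> uv cG; set F : R -> R := fun t => affine u v (cos t).
have F0 : F 0 = v by rewrite /F cos0 /affine; field.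
have Fpi : F pi = u by rewrite /F cospi /affine; field.
have dF : F^`()%classic = fun t => - ((v - u) / 2 * sin t).
  apply/funext => t; rewrite derive1E.
  by have -> := @derive_val _ _ _ _ _ _ _ (is_derive_affine_cos t).
have cdF : continuous F^`()%classic.
  rewrite dF => t; apply: cvgN; apply: cvgM; first exact: cvg_cst.
  exact: continuous_sin.
have cF := continuous_affine_cos.
rewrite -RintegralZl //; last first.
  apply: integrable_within; apply: within_continuousM.
    exact: within_affine_cos (ltW uv) cG.
  exact: continuous_subspaceT (@continuous_sin R).
rewrite /Rintegral -{1}F0 -{1}Fpi.
rewrite (@integration_by_substitution_decreasing R F G 0 pi) ?F0 ?Fpi //.
(* The sign from reversing orientation cancels the sign of the derivative of [F]. *)
- congr fine; apply: eq_integral => t _; rewrite fctE /= dF /F; congr EFin.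
  by rewrite /= fctE opprK; ring.
- exact: pi_ge0.
- move=> x y x0 y0 yx; rewrite /F /affine.
  have : cos x < cos y by rewrite ltr_cos.
  nra.
- exact: cvgP (cvg_at_right_filter (cdF _)).
- exact: cvgP (cvg_at_left_filter (cdF _)).
- split.
  + by move=> t _; have [] := is_derive_affine_cos t.
  + by apply: cvg_at_right_filter; exact: cF.
  + by apply: cvg_at_left_filter; exact: cF.
Qed.

End CosineSubstitution.

(** * A feasible pair on one interval *)

Section ErsatzBound.
Context {R : realType} {u v : R} {w : R -> R}.
Hypotheses (uv : u < v) (cw : {within `[u, v], continuous w}).
Hypothesis w_gt0 : forall t, t \in `[u, v] -> 0 < w t.

(** The density $g$ of the overview; [sin t] comes from the Jacobian of the substitution. *)
Definition sine_density (u v : R) (w : R -> R) (P : {poly R}) (t : R) : R :=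
  P.[affine u v (cos t)] / w (affine u v (cos t)) * sin t.

Lemma within_inv_weight : {within `[u, v], continuous (fun x => (w x)^-1)}.
Proof.
apply/subspace_continuousP => x xuv; apply: cvgV.
  by rewrite gt_eqF // w_gt0.
by move/subspace_continuousP : cw; exact.
Qed.

Lemma within_sine_density (P : {poly R}) (D : set R) :
  {within D, continuous (sine_density u v w P)}.
Proof.
apply: within_continuousM; last exact: continuous_subspaceT (@continuous_sin R).
apply: (@within_affine_cos R u v D (fun x => P.[x] / w x)); first exact: ltW.
apply: within_continuousM within_inv_weight.
exact: continuous_subspaceT (@continuous_horner _ P).
Qed.

(** The Jacobian factor [sin t] turns each $U_n(\cos t)$ into $\sin((n+1)t)$, which is why [Wmx]
    targets the second-kind basis. *)
Lemma sine_density_cheb (N : nat) (P : {poly R}) (t : R) :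
  (size P <= N.+1)%N ->
  sine_density u v w P t =
  \sum_(n < N.+1) (Wmx N u v *m coords (@chebT R) N P) n ord0 *
    (sin (n.+1%:R * t) / w (affine u v (cos t))).
Proof.
move=> sP; rewrite /sine_density -affine_polyE -horner_comp.
rewrite {1}(coordsE (@size_chebT R) sP) WmxE horner_sum !mulr_suml.
by apply: eq_bigr => n _; rewrite hornerZ -chebU_cos; ring.
Qed.

Lemma Jmx_moments (d N : nat) (P : {poly R}) : (size P <= N.+1)%N ->
  Jmx d N w u v *m (Wmx N u v *m coords (@chebT R) N P) =
  moments d (sine_density u v w P).
Proof.
move=> sP; apply/colP => k; set c := Wmx N u v *m _.
have cJ n : {within `[0, pi], continuous (fun t =>
    cos (k%:R * t) * sin (n.+1%:R * t) / w (affine u v (cos t)))}.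
  apply: within_continuousM.
    apply: within_cosM; apply: continuous_subspaceT => t.
    apply: (@continuous_comp _ _ _ (fun t : R => n.+1%:R * t) sin).
      exact: mulrl_continuous.
    exact: continuous_sin.
  exact: within_affine_cos (ltW uv) within_inv_weight.
rewrite !mxE; transitivity (\int[lebesgue_measure]_(t in `[0, pi])
    (\sum_(n < N.+1) c n ord0 * (cos (k%:R * t) * sin (n.+1%:R * t) /
                            w (affine u v (cos t))))).
  rewrite Rintegral_sum // => [|n].
    apply: eq_bigr => n _; rewrite RintegralZl //.
      by rewrite mulrC [Jmx _ _ _ _ _ _ _]mxE.
    exact: integrable_within (cJ n).
  apply: integrable_within; apply: within_continuousM (cJ n).
  by move=> t; exact: cvg_cst.
apply: eq_Rintegral => t _; rewrite (sine_density_cheb _ _ _ sP) mulr_sumr.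
by apply: eq_bigr => n _; ring.
Qed.

(** Both [sin] on $[0,\pi]$ and [w] on $[u,v]$ are nonnegative, so the absolute value extends from
    [P] to the whole density. *)
Lemma Rintegral_norm_sine_density (P : {poly R}) :
  \int[lebesgue_measure]_(x in `[u, v]) (`|P.[x]| / w x) =
  (v - u) / 2 * \int[lebesgue_measure]_(t in `[0, pi])
    `|sine_density u v w P t|.
Proof.
rewrite Rintegral_affine_cos //; last first.
  apply: within_continuousM within_inv_weight.
  apply: continuous_subspaceT => x.
  by apply: cvg_norm; exact: continuous_horner.
congr (_ * _); apply: eq_Rintegral => t; rewrite inE /= in_itv /= => t0pi.
have wF := w_gt0 _ (affine_cos_itv t (ltW uv)).
by rewrite !normrM normfV (ger0_norm (sin_ge0_pi t0pi)) (gtr0_norm wF).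
Qed.

(** The positive and negative parts of the density differ by $g$ and add up to $|g|$. Packing both
    vectors into one [y] allows a single use of [choice] over the intervals. *)
Lemma ersatz_feasible_pair (d N : nat) (P : {poly R}) : (size P <= N.+1)%N ->
  exists y : 'cV[R]_d.+1 * 'cV[R]_d.+1,
  [/\ y.1 - y.2 = Jmx d N w u v *m (Wmx N u v *m coords (@chebT R) N P),
      psd (Toep y.1), psd (Toep y.2) &
      (v - u) / 2 * (y.1 ord0 ord0 + y.2 ord0 ord0) =
      \int[lebesgue_measure]_(x in `[u, v]) (`|P.[x]| / w x)].
Proof.
move=> sP; set g := sine_density u v w P.
have cg : {within `[0, pi], continuous g} by exact: within_sine_density.
have cng : {within `[0, pi], continuous (fun t => `|g t|)}.
  by move=> t; apply: cvg_norm; exact: cg.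
have cpos : {within `[0, pi], continuous (fun t => (`|g t| + g t) / 2)}.
  by move=> t; apply: cvgM; [apply: cvgD; [exact: cng|exact: cg]|exact: cvg_cst].
have cneg : {within `[0, pi], continuous (fun t => (`|g t| - g t) / 2)}.
  by move=> t; apply: cvgM; [apply: cvgB; [exact: cng|exact: cg]|exact: cvg_cst].
(* The formulas $(|g|\pm g)/2$ for the two parts make their continuity immediate. *)
exists (moments d (fun t => (`|g t| + g t) / 2),
        moments d (fun t => (`|g t| - g t) / 2)); split => /=.
- rewrite momentsB // Jmx_moments // -/g; congr moments.
  by apply/funext => t; field.
- apply: psd_moments => // t _; rewrite divr_ge0 //.
  by have := ler_norm (- g t); rewrite normrN; lra.
- apply: psd_moments => // t _; rewrite divr_ge0 //.
  by have := ler_norm (g t); lra.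
- rewrite moments0D // Rintegral_norm_sine_density -/g; congr (_ * _).
  by apply: eq_Rintegral => t _; field.
Qed.

End ErsatzBound.

(** * Comparison of the norms and of the minimizers *)

(** The constraints decouple over the intervals, so the pairs found on each one form a feasible
    point whose objective is exactly the weighted norm. *)
Lemma ersatz_norm_le_wL1norm (R : realType) (L : nat) (a b : 'I_L.+1 -> R)
    (w : R -> R) (N d : nat) (P : {poly R}) :
  (forall l, a l < b l) ->
  {within Kset a b, continuous w} ->
  (forall t : R, Kset a b t -> 0 < w t) ->
  (size P <= N.+1)%N ->
  ersatz_norm a b w N d P <= wL1norm a b w P.
Proof.
move=> ab cw w_gt0 sP.
have sub l : `[a l, b l] `<=` Kset a b by move=> t tl; exists l.
have [y hy] := choice (fun l => ersatz_feasible_pair (ab l)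
  (continuous_subspaceW (sub l) cw) (fun t tl => w_gt0 t (sub l t tl)) d N P sP).
have [_ /(_ (fun l => (y l).1) (fun l => (y l).2))] :=
  @ersatz_norm_min R L a b w N d P (fun l => ltW (ab l)).
have -> : ersatz_objective a b (fun l => (y l).1) (fun l => (y l).2) =
    wL1norm a b w P by apply: eq_bigr => l _; have [] := hy l.
by apply => l; have [] := hy l.
Qed.

Lemma wL1norm_ge0 (R : realType) (L : nat) (a b : 'I_L.+1 -> R) (w : R -> R)
    (P : {poly R}) :
  (forall t : R, Kset a b t -> 0 < w t) -> 0 <= wL1norm a b w P.
Proof.
move=> w_gt0; apply: sumr_ge0 => l _; apply: Rintegral_ge0 => t tl.
by rewrite divr_ge0 // ltW // w_gt0 //; exists l.
Qed.

Theorem proposition6 (R : realType) (L : nat) (a b : 'I_L.+1 -> R)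
    (w : R -> R) (N d : nat) (U V : {poly R})
    (ha : a ord0 = -1) (hb : b ord_max = 1)
    (hab : forall l : 'I_L.+1, a l < b l)
    (hba : forall l m : 'I_L.+1, nat_of_ord m = (nat_of_ord l).+1 -> b l < a m)
    (hwc : {within Kset a b, continuous w})
    (hw0 : forall t : R, Kset a b t -> 0 < w t)
    (hNd : (N <= d)%N)
    (hU : is_minimizer (@monic_deg R N) (wL1norm a b w) U)
    (hV : is_minimizer (@monic_deg R N) (ersatz_norm a b w N d) V) :
  let delta : R := 1 - ersatz_norm a b w N d V / wL1norm a b w V in
  [/\ ersatz_norm a b w N d V <= wL1norm a b w U,
      wL1norm a b w U <= wL1norm a b w V,
      0 <= delta &
      (1 - delta) * wL1norm a b w V <= wL1norm a b w U <= wL1norm a b w V].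
Proof.
have ersatz_le P := @ersatz_norm_le_wL1norm R L a b w N d P hab hwc hw0.
have L1V_ge0 := wL1norm_ge0 R L a b w V hw0.
have L1U_ge0 := wL1norm_ge0 R L a b w U hw0.
have [AU minU] := hU; have [AV minV] := hV.
have EV : ersatz_norm a b w N d V <= wL1norm a b w V.
  by apply: ersatz_le; rewrite AV.2.
have VU : ersatz_norm a b w N d V <= wL1norm a b w U.
  by apply: le_trans (minV _ AU) _; apply: ersatz_le; rewrite AU.2.
have UV := minU _ AV; move=> delta.
split => //; rewrite /delta.
  (* If the denominator were 0, the quotient would be 0 by convention and [delta] would be 1. *)
  rewrite subr_ge0; have [->|V0] := eqVneq (wL1norm a b w V) 0.
    by rewrite invr0 mulr0.
  by rewrite ler_pdivrMr ?mul1r // lt_def V0.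
rewrite UV andbT opprB addrC subrK.
(* In the zero case the left side vanishes and [L1U_ge0] concludes; otherwise it is the ersatz norm
   of [V]. *)
have [->|V0] := eqVneq (wL1norm a b w V) 0; first by rewrite mulr0.
by rewrite divfK.
Qed.
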